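(* The Petersen code is an optimal $(4,10,1/6)$ spherical code. Moreover, it is the unique spherical code with these parameters up to orthogonal transformations: if $C \subseteq S^3 \subseteq \mathbb{R}^4$ is any $(4,10,1/6)$ spherical code, then there is an orthogonal transformation of $\mathbb{R}^4$ mapping $C$ onto the Petersen code.
   Context: Let $S^{n-1} \subseteq \mathbb{R}^n$ denote the unit sphere, and let $x \cdot y$ denote the standard inner product. An $N$-element subset $C \subseteq S^{n-1}$ is called an $(n,N,t)$ spherical code if $c \cdot c' \le t$ for every two distinct points $c, c' \in C$. An $(n,N,t)$ spherical code is called optimal if there is no $(n,N,t')$ spherical code with $t' < t$. The Petersen code is the set of $10$ points of $S^3$ obtained from the midpoints of the $10$ edges of a regular simplex in $\mathbb{R}^4$ (with $5$ vertices, centered at the origin) by rescaling them to unit length; it is well defined up to orthogonal transformations. Equivalently, its points can be indexed by the $2$-element subsets of $\{1,\dots,5\}$ so that two distinct points have inner product $-2/3$ if the corresponding subsets are disjoint and $1/6$ if the corresponding subsets intersect in exactly one element (the Gram matrix with these entries and unit diagonal has rank $4$). *)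

(* Defs.v *)
From mathcomp Require Import all_boot all_order all_algebra.
From mathcomp Require Import finmap.
From mathcomp Require Import reals.
From mathcomp Require Import ring lra.

Set Implicit Arguments.
Unset Strict Implicit.
Unset Printing Implicit Defensive.

Import Order.TTheory GRing.Theory Num.Theory.

Local Open Scope ring_scope.
Local Open Scope fset_scope.

Definition dot (R : realType) (n : nat) (x y : 'rV[R]_n) : R :=
  \sum_(i < n) x 0 i * y 0 i.

(* The norm that MathComp-Analysis puts on matrices is the sup norm,
   hence this separate Euclidean norm. *)
Definition enorm (R : realType) (n : nat) (x : 'rV[R]_n) : R :=
  Num.sqrt (dot x x).

Definition spherical_code (R : realType) (n N : nat) (t : R)
    (C : {fset 'rV[R]_n}) : Prop :=
  [/\ #|` C| = N,
      forall c, c \in C -> enorm c = 1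
    & forall c c', c \in C -> c' \in C -> c <> c' -> dot c c' <= t].

Definition optimal_code (R : realType) (n N : nat) (t : R)
    (C : {fset 'rV[R]_n}) : Prop :=
  spherical_code N t C /\
  ~ (exists (t' : R) (C' : {fset 'rV[R]_n}), t' < t /\ spherical_code N t' C').

(* Orthogonal matrices act on row vectors by x |-> x *m Q. *)
Definition orthogonal_mx (R : realType) (n : nat) (Q : 'M[R]_n) : Prop :=
  Q *m Q^T = 1%:M.

Definition centered_regular_simplex (R : realType) (n : nat)
    (v : 'I_n.+1 -> 'rV[R]_n) : Prop :=
  \sum_i v i = 0 /\
  exists2 d : R, 0 < d & forall i j, i != j -> enorm (v i - v j) = d.

Definition normalize (R : realType) (n : nat) (x : 'rV[R]_n) : 'rV[R]_n :=
  (enorm x)^-1 *: x.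

(* An edge is the set of its two endpoints. *)
Definition edge_midpoint (R : realType) (n : nat) (v : 'I_n.+1 -> 'rV[R]_n)
    (e : {set 'I_n.+1}) : 'rV[R]_n :=
  2^-1 *: \sum_(i in e) v i.

Definition petersen_code (R : realType) (v : 'I_5 -> 'rV[R]_4) :
    {fset 'rV[R]_4} :=
  [fset normalize (edge_midpoint v e) | e : {set 'I_5} & #|e| == 2%N].

Lemma centered_regular_simplex_exists (R : realType) :
  exists v : 'I_5 -> 'rV[R]_4, centered_regular_simplex v.
Proof.
pose s : R := Num.sqrt 5.
have s2 : s * s = 5 by rewrite -expr2 sqr_sqrtr.
pose w (i : 'I_5) (j : 'I_4) : R :=
  (if i == 4%N :> nat then (1 + s) / 4 else ((i == j :> nat)%:R)) - (5 + s) / 20.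
exists (fun i => \row_j w i j); split.
  apply/rowP=> j; rewrite summxE !big_ord_recl big_ord0 !mxE /w /=.
  by case: j => [[|[|[|[|]]]] ?] //=; field.
exists (Num.sqrt 2); first by rewrite sqrtr_gt0.
move=> i j ij; congr Num.sqrt.
rewrite /dot !big_ord_recl big_ord0 !mxE /w /=.
move: ij.
by case: i => [[|[|[|[|[|]]]]] ?] //=; case: j => [[|[|[|[|[|]]]]] ?] //= _; nra.
Qed.

(* Main.v *)
Require Import Defs.
From mathcomp Require Import all_boot all_order all_algebra.
From mathcomp Require Import finmap.
From mathcomp Require Import reals.
From mathcomp Require Import ring lra.

Set Implicit Arguments.
Unset Strict Implicit.
Unset Printing Implicit Defensive.

Import Order.TTheory GRing.Theory Num.Theory.

Local Open Scope ring_scope.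

(** Why the theorem holds.  Measure the inner product of two unit vectors by
    their gap p = (1 - 6 x.y) / 5.  The gap is -1 when the vectors coincide, it
    is nonnegative exactly when x.y <= 1/6, and the inner products 1/6 and -2/3
    of the Petersen code become the gaps 0 and 1.

    Two kinds of sums over a code are nonnegative for geometric reasons.  For a
    fixed point x, projecting the other points on the hyperplane orthogonal to x
    gives vectors with a positive semidefinite Gram matrix
    ([projected_gram_ge0]); and the sum of (x.y)^2 - 1/4 over all pairs is the
    squared distance of the frame operator, the sum of all x^T x, from a scalar
    matrix ([frame_deviation]).  A suitable combination of such sums is the sum,
    over all triples of code points, of one symmetric polynomial in the three
    gaps of the triple ([triple_kernel_sum]).  For a code of exactly ten points,
    triples with repeated points can be redistributed over triples of distinct
    points ([sum_triples]), after which the polynomial becomes minus an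
    expression [slack] that is visibly nonnegative when the three gaps are
    ([triple_kernel_certificate]).  So every nonnegative quantity in sight is
    zero.  This is the semidefinite three-point bound, sharp for ten points.

    Vanishing of [slack] forces every gap to be 0 or 1, and vanishing of the
    frame term makes the code a tight frame ([ten_point_rigidity]).  Hence the
    Gram matrix G satisfies G^2 = (5/2) G, and reading this entrywise says that
    the pairs at inner product -2/3 form a graph in which every point has three
    neighbours, adjacent points have no common neighbour and other pairs have
    exactly one ([card_common_obtuse]).  The Petersen graph is the only such
    graph on ten vertices ([petersen_labelling]), so any two (4, 10, 1/6) codes
    have equal Gram matrices after relabelling; being tight frames, they differ
    by an orthogonal matrix given by an explicit formula
    ([congruent_families]).  Since the Petersen code is a (4, 10, 1/6) code,
    uniqueness follows.  Optimality follows as well: a code with a smaller bound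
    would be one of these codes, and they all attain the inner product 1/6
    ([code_attains]). *)

(** * The inner product *)

Section InnerProduct.
Variables (R : realType) (n : nat).
Implicit Types (x y z : 'rV[R]_n) (a : R).

Lemma dotC x y : dot x y = dot y x.
Proof. by apply: eq_bigr => i _; rewrite mulrC. Qed.

Lemma dotDl x y z : dot (x + y) z = dot x z + dot y z.
Proof. by rewrite -big_split; apply: eq_bigr => i _; rewrite mxE mulrDl. Qed.

Lemma dotZl a x y : dot (a *: x) y = a * dot x y.
Proof. by rewrite /dot mulr_sumr; apply: eq_bigr => i _; rewrite mxE mulrA. Qed.

Lemma dotDr x y z : dot x (y + z) = dot x y + dot x z.
Proof. by rewrite dotC dotDl !(dotC x). Qed.

Lemma dotZr a x y : dot x (a *: y) = a * dot x y.
Proof. by rewrite dotC dotZl (dotC x). Qed.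

Lemma dotBl x y z : dot (x - y) z = dot x z - dot y z.
Proof. by rewrite -scaleN1r dotDl dotZl mulN1r. Qed.

Lemma dotBr x y z : dot x (y - z) = dot x y - dot x z.
Proof. by rewrite dotC dotBl !(dotC x). Qed.

Lemma dot0l x : dot 0 x = 0.
Proof. by rewrite -(scale0r 0) dotZl mul0r. Qed.

Lemma dot_suml (I : Type) (s : seq I) (P : pred I) (f : I -> 'rV[R]_n) y :
  dot (\sum_(i <- s | P i) f i) y = \sum_(i <- s | P i) dot (f i) y.
Proof.
by elim/big_rec2: _ => [|i a z _ <-]; rewrite ?dot0l // dotDl.
Qed.

Lemma dot_sumr (I : Type) (s : seq I) (P : pred I) (f : I -> 'rV[R]_n) y :
  dot y (\sum_(i <- s | P i) f i) = \sum_(i <- s | P i) dot y (f i).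
Proof. by rewrite dotC dot_suml; apply: eq_bigr => i _; rewrite dotC. Qed.

Lemma dot_ge0 x : 0 <= dot x x.
Proof. by apply: sumr_ge0 => i _; rewrite -expr2 sqr_ge0. Qed.

Lemma dot_mulmx (m k : nat) (A : 'M[R]_(m, n)) (B : 'M[R]_(k, n)) i j :
  (A *m B^T) i j = dot (row i A) (row j B).
Proof. by rewrite mxE; apply: eq_bigr => l _; rewrite !mxE. Qed.

Lemma enorm_eq1 x : enorm x = 1 -> dot x x = 1.
Proof. by move=> h; rewrite -(sqr_sqrtr (dot_ge0 x)) -/(enorm x) h expr1n. Qed.

End InnerProduct.

(** * Double and triple sums over a finite type *)

Section Sums.
Variables (R : realType) (T : finType).
Implicit Types (k l : T -> T -> R) (F : T -> T -> T -> R).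

Lemma dsumD_ge0 k l :
  0 <= \sum_x \sum_y k x y -> 0 <= \sum_x \sum_y l x y ->
  0 <= \sum_x \sum_y (k x y + l x y).
Proof.
move=> hk hl; under eq_bigr do rewrite big_split.
by rewrite big_split addr_ge0.
Qed.

Lemma dsumZ_ge0 (a : R) k :
  0 <= a -> 0 <= \sum_x \sum_y k x y -> 0 <= \sum_x \sum_y a * k x y.
Proof.
move=> ha hk; under eq_bigr do rewrite -mulr_sumr.
by rewrite -mulr_sumr mulr_ge0.
Qed.

Lemma dsum_square_ge0 (f : T -> R) : 0 <= \sum_x \sum_y f x * f y.
Proof.
suff <- : (\sum_x f x) ^+ 2 = \sum_x \sum_y f x * f y by apply: sqr_ge0.
by rewrite expr2 big_distrlr.
Qed.

Definition distinct3 (x y z : T) := [&& x != y, x != z & y != z].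

Definition sum3 F : R := \sum_x \sum_y \sum_(z | distinct3 x y z) F x y z.

Lemma sum3E F :
  sum3 F = \sum_x \sum_y \sum_z (if distinct3 x y z then F x y z else 0).
Proof. by do 2!apply: eq_bigr => ? _; rewrite -big_mkcond. Qed.

Lemma sum3D F F' : sum3 (fun x y z => F x y z + F' x y z) = sum3 F + sum3 F'.
Proof.
rewrite /sum3 -big_split; apply: eq_bigr => x _; rewrite -big_split.
by apply: eq_bigr => y _; rewrite -big_split.
Qed.

Lemma sum3M F (a : R) : sum3 (fun x y z => F x y z * a) = sum3 F * a.
Proof.
rewrite /sum3 mulr_suml; apply: eq_bigr => x _; rewrite mulr_suml.
by apply: eq_bigr => y _; rewrite mulr_suml.
Qed.

Lemma sum3_swap12 F : sum3 F = sum3 (fun x y z => F y x z).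
Proof.
rewrite !sum3E exchange_big; do 3!apply: eq_bigr => ? _.
by rewrite /distinct3 eq_sym; case: (_ != _) => //=; rewrite andbC.
Qed.

Lemma sum3_swap23 F : sum3 F = sum3 (fun x y z => F x z y).
Proof.
rewrite !sum3E; apply: eq_bigr => x _; rewrite exchange_big.
do 2!apply: eq_bigr => ? _.
by rewrite /distinct3 andbCA [in X in [&& _, _ & X]]eq_sym.
Qed.

Lemma eq_sum3 F F' :
  (forall x y z, distinct3 x y z -> F x y z = F' x y z) -> sum3 F = sum3 F'.
Proof.
by move=> eqF; do 3!apply: eq_bigr => ? ?; apply: eqF.
Qed.

Hypothesis cardT : #|T| = 10%N.

Lemma sum3_pair k :
  sum3 (fun x y _ => k x y) = 8 * \sum_x \sum_(y | x != y) k x y.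
Proof.
rewrite mulr_sumr; apply: eq_bigr => x _.
rewrite mulr_sumr [RHS]big_mkcond; apply: eq_bigr => y _.
case: ifPn => [xy|/negPn/eqP->]; last first.
  by rewrite big1 // => z; rewrite /distinct3 eqxx.
rewrite sumr_const -[8]/(8%:R) mulr_natl; congr (_ *+ _).
have := cardC [set x; y]; rewrite cards2 xy cardT => /= -[] <-.
by apply: eq_card => z; rewrite !inE negb_or !(eq_sym z).
Qed.

(** A sum over all triples can be carried by the triples of distinct points
    alone, because each ordered pair of distinct points extends to 8 of them and
    each point to 72.  The three ways for exactly two entries to coincide are
    spread over the three different pairs inside a triple, which keeps a
    symmetric summand symmetric. *)
Lemma sum_triples F :
  \sum_x \sum_y \sum_z F x y z =
  sum3 (fun x y z => F x y z + (F x x y + F x z x + F y z z) / 8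
                     + F x x x / 72).
Proof.
have split_diag (k : T -> R) x :
    \sum_y k y = k x + \sum_(y | x != y) k y.
  by rewrite (bigD1 x) //; congr (_ + _); apply: eq_bigl => y; rewrite eq_sym.
have inner x y : x != y -> \sum_z F x y z =
    F x y x + F x y y + \sum_(z | distinct3 x y z) F x y z.
  move=> xy; rewrite (split_diag _ x) (bigD1 y) //= addrA; congr (_ + _).
  by apply: eq_bigl => z; rewrite /distinct3 xy (eq_sym z y).
have middle u : \sum_y \sum_z F u y z = F u u u
    + \sum_(y | u != y) (F u u y + F u y u + F u y y)
    + \sum_y \sum_(z | distinct3 u y z) F u y z.
  rewrite (split_diag _ u) (split_diag _ u) (eq_bigr _ (inner u)).
  rewrite [X in _ = _ + X](split_diag _ u) [X in _ = _ + (X + _)]big1; last first.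
    by move=> z; rewrite /distinct3 eqxx.
  rewrite !big_split /=; lra.
under eq_bigr do rewrite middle.
rewrite !big_split /= -/(sum3 F).
have pair (k : T -> T -> R) :
    \sum_x \sum_(y | x != y) k x y = sum3 (fun x y _ => k x y) / 8.
  by rewrite sum3_pair; lra.
have diag : \sum_x F x x x = sum3 (fun x _ _ => F x x x) / 72.
  rewrite sum3_pair mulr_sumr mulr_suml; apply: eq_bigr => x _.
  have /eqP : (#|[set x]| + #|[set y | x != y]| = 10)%N.
    rewrite -cardT -(cardC (mem [set x])); congr addn.
    by apply: eq_card => y; rewrite !inE eq_sym.
  rewrite cards1 add1n eqSS => /eqP c9.
  rewrite -(eq_bigl _ _ (fun y => in_set (fun y => x != y) y)).
  rewrite sumr_const c9 -mulr_natl.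
  by lra.
rewrite diag pair !sum3D !sum3M !sum3D.
rewrite [sum3 (fun x y _ => F x y x)]sum3_swap23.
rewrite [sum3 (fun x y _ => F x y y)]sum3_swap23.
rewrite [sum3 (fun x _ z => F x z z)]sum3_swap12.
lra.
Qed.
End Sums.

(** * The polynomial certificate *)

Section Certificate.
Variable R : realType.
Implicit Types p q r : R.

(** Up to the factor 36/5, the Gram matrix of the projections on the hyperplane
    orthogonal to the base point: the entry is y.z - (x.y)(x.z), where p, q, r
    are the gaps of (x, y), (x, z), (y, z). *)
Definition transverse p q r : R := 1 + p + q - 6 * r - 5 * (p * q).

(** For a fixed base point x this kernel in (y, z) is positive semidefinite: a
    sum of squares m(p) m(q), and of such squares multiplied by a positive
    semidefinite Gram matrix.  Each m in the first two squares sums to zero over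
    the Petersen code seen from one of its points, that is
    m(-1) + 3 m(1) + 6 m(0) = 0, as a sharp bound requires.  The coefficients
    here and in [slack] solve a linear program that asks for
    [triple_kernel_certificate]; they are one solution among many, selected for
    small numbers. *)
Definition base_kernel p q r : R :=
  72 * ((1 + 5 * p - 10 * p ^+ 3) * (1 + 5 * q - 10 * q ^+ 3))
  + 2400 * ((p - p ^+ 3) * (q - q ^+ 3))
  + 1740 * (p ^+ 2 * q ^+ 2 * transverse p q r)
  + 60 * ((p + 2 * p ^+ 2) * (q + 2 * q ^+ 2) * transverse p q r)
  + 60 * ((1 - 3 * p ^+ 2) * (1 - 3 * q ^+ 2) * transverse p q r)
  + 180 * ((1 + p - 2 * p ^+ 2) * (1 + q - 2 * q ^+ 2) * transverse p q r)
  + 360 * ((1 + p - p ^+ 2) * (1 + q - q ^+ 2) * transverse p q r).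

(** 36 ((x.y)^2 - 1/4) in terms of the gap; 1/4 is the mean of (x.y)^2 over the
    sphere in dimension 4. *)
Definition frame_kernel p : R := 25 * p ^+ 2 - 10 * p - 8.

Definition triple_kernel p q r : R :=
  base_kernel p q r + base_kernel p r q + base_kernel q r p
  + 216 * (frame_kernel p + frame_kernel q + frame_kernel r).

(** The three kinds of terms of [slack] vanish at the gap triples of the
    Petersen code, which are the vertices of the unit cube other than (1, 1, 1): the
    Petersen graph has no triangle. *)
Definition slack1 p : R :=
  p * (p - 1) ^+ 2 * (575 * (2 * p - 1) ^+ 2 + 250 * (p - 2) ^+ 2).

Definition slack2 p q r : R :=
  p * q * (1350 * (p * q - 1) ^+ 2
           + 1950 * (2 * r - p - q + 1 + p * q) ^+ 2
           + 1200 * (2 * r - p - q + 2 * (p * q)) ^+ 2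
           + 150 * (2 * r - p * q + 1) ^+ 2
           + 1200 * (2 * r + p * q - 1) ^+ 2).

Definition slack3 p q : R :=
  525 * ((p - q) ^+ 2
         * (2 * p + 2 * q - 1 - p ^+ 2 - p * q - q ^+ 2) ^+ 2).

Definition slack p q r : R :=
  slack1 p + slack1 q + slack1 r + slack2 p q r + slack2 p r q + slack2 q r p
  + slack3 p q + slack3 p r + slack3 q r.

(** The left side is what [sum_triples] makes of [triple_kernel]; gap -1 encodes
    coinciding points. *)
Lemma triple_kernel_certificate p q r :
  triple_kernel p q r
  + (triple_kernel (- 1) p p + triple_kernel q (- 1) q
     + triple_kernel r r (- 1)) / 8
  + triple_kernel (- 1) (- 1) (- 1) / 72 = - slack p q r.
Proof.
rewrite /triple_kernel /frame_kernel /base_kernel /transverse.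
by rewrite /slack /slack1 /slack2 /slack3; field.
Qed.

Lemma natr_sqr_ge0 n p : 0 <= n%:R * p ^+ 2.
Proof. by rewrite mulr_ge0 ?ler0n ?sqr_ge0. Qed.

Lemma slack1_ge0 p : 0 <= p -> 0 <= slack1 p.
Proof.
move=> p0; apply: mulr_ge0; first by rewrite (mulr_ge0 p0) ?sqr_ge0.
by rewrite addr_ge0 ?natr_sqr_ge0.
Qed.

Lemma slack2_ge0 p q r : 0 <= p -> 0 <= q -> 0 <= slack2 p q r.
Proof.
move=> p0 q0; apply: mulr_ge0; first exact: mulr_ge0.
by rewrite !addr_ge0 ?natr_sqr_ge0.
Qed.

Lemma slack3_ge0 p q : 0 <= slack3 p q.
Proof. by rewrite mulr_ge0 ?ler0n // mulr_ge0 ?sqr_ge0. Qed.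

Lemma slack1_le_slack p q r :
  0 <= p -> 0 <= q -> 0 <= r -> slack1 p <= slack p q r.
Proof.
move=> p0 q0 r0.
have := slack1_ge0 q0; have := slack1_ge0 r0.
have := slack2_ge0 r p0 q0; have := slack2_ge0 q p0 r0.
have := slack2_ge0 p q0 r0.
have := slack3_ge0 p q; have := slack3_ge0 p r; have := slack3_ge0 q r.
rewrite /slack; lra.
Qed.

Lemma slack_ge0 p q r : 0 <= p -> 0 <= q -> 0 <= r -> 0 <= slack p q r.
Proof.
move=> p0 q0 r0; apply: le_trans (slack1_le_slack p0 q0 r0).
exact: slack1_ge0.
Qed.

(** Away from p = 0 and p = 1, both 2p - 1 and p - 2 would have to vanish. *)
Lemma slack1_eq0 p : slack1 p = 0 -> p = 0 \/ p = 1.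
Proof.
move=> /eqP; rewrite /slack1 mulf_eq0 => /orP[|/eqP h]; last first.
  by have := sqr_ge0 (2 * p - 1); have := sqr_ge0 (p - 2); nra.
rewrite mulf_eq0 sqrf_eq0 subr_eq0 => /orP[] /eqP ->; first by left.
by right.
Qed.
End Certificate.

(** * Positive semidefinite kernels on a spherical code *)

Section Frame.
Variables (R : realType) (n : nat) (T : finType) (c : T -> 'rV[R]_n).

Definition frame_mx : 'M[R]_n := \matrix_(a, b) \sum_t c t 0 a * c t 0 b.

Lemma frame_mxE (u v : 'rV[R]_n) :
  dot (u *m frame_mx) v = \sum_t dot u (c t) * dot (c t) v.
Proof.
rewrite /dot; under eq_bigr do rewrite mxE mulr_suml.
under [RHS]eq_bigr do rewrite big_distrlr.
rewrite [LHS]exchange_big [RHS]exchange_big /=; apply: eq_bigr => a _.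
rewrite [RHS]exchange_big; apply: eq_bigr => b _.
rewrite mxE mulr_sumr mulr_suml; apply: eq_bigr => t _.
by rewrite !mulrA.
Qed.

(** Both [frame_mx] and the Gram matrix come from the same rectangular matrix, so
    they have the same trace and the same Hilbert-Schmidt norm. *)
Lemma frame_deviation (s : R) :
  \sum_a \sum_b (frame_mx - s%:M) a b ^+ 2 =
  \sum_x \sum_y dot (c x) (c y) ^+ 2 - 2 * s * (\sum_t dot (c t) (c t))
  + s ^+ 2 * n%:R.
Proof.
have -> : \sum_x \sum_y dot (c x) (c y) ^+ 2 =
    \sum_a \sum_b frame_mx a b ^+ 2.
  transitivity (\sum_x \sum_a \sum_b c x 0 a * (frame_mx a b * c x 0 b)).
    apply: eq_bigr => x _; have := frame_mxE (c x) (c x).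
    under [X in _ = X -> _]eq_bigr do rewrite (dotC (c _) (c x)) -expr2.
    move=> <-; rewrite /dot exchange_big; apply: eq_bigr => b _.
    by rewrite mxE mulr_suml; apply: eq_bigr => a _; rewrite mulrA.
  rewrite exchange_big; apply: eq_bigr => a _.
  rewrite exchange_big; apply: eq_bigr => b _.
  have e : frame_mx a b = \sum_t c t 0 a * c t 0 b by rewrite mxE.
  rewrite expr2 {3}e mulr_sumr; apply: eq_bigr => x _; ring.
have -> : \sum_t dot (c t) (c t) = \sum_a frame_mx a a.
  by rewrite exchange_big; apply: eq_bigr => a _; rewrite mxE.
have -> : n%:R = \sum_(a < n) 1 :> R by rewrite sumr_const card_ord.
rewrite !mulr_sumr -sumrB -big_split /=; apply: eq_bigr => a _.
have entry b : (frame_mx - s%:M) a b = frame_mx a b - s *+ (a == b).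
  by rewrite !mxE.
rewrite (bigD1 a) //= [in RHS](bigD1 a) //= entry eqxx mulr1n.
rewrite (eq_bigr (fun b => frame_mx a b ^+ 2)); last first.
  by move=> b ba; rewrite entry eq_sym (negPf ba) mulr0n subr0.
by ring.
Qed.

End Frame.

Section ZonalKernels.
Variables (R : realType) (n : nat) (T : finType) (c : T -> 'rV[R]_n).
Hypothesis unit_c : forall t, dot (c t) (c t) = 1.

(** The sum is the squared norm of the component of the combination of all
    [f y *: c y] that is orthogonal to the unit vector [c x]. *)
Lemma projected_gram_ge0 x (f : T -> R) :
  0 <= \sum_y \sum_z f y * f z
         * (dot (c y) (c z) - dot (c x) (c y) * dot (c x) (c z)).
Proof.
pose w := \sum_y f y *: c y.
have ww : dot w w = \sum_y \sum_z f y * f z * dot (c y) (c z).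
  rewrite dot_suml; apply: eq_bigr => y _; rewrite dotZl dot_sumr mulr_sumr.
  by apply: eq_bigr => z _; rewrite dotZr mulrA.
have xw : dot (c x) w = \sum_y f y * dot (c x) (c y).
  by rewrite dot_sumr; apply: eq_bigr => y _; rewrite dotZr.
have := dot_ge0 (w - dot (c x) w *: c x).
rewrite !(dotBl, dotBr, dotZl, dotZr) unit_c (dotC w (c x)).
rewrite mulr1 subrr mulr0 subr0.
rewrite ww xw big_distrlr -sumrB => /le_trans; apply.
rewrite le_eqVlt; apply/orP; left; apply/eqP; apply: eq_bigr => y _.
by rewrite -sumrB; apply: eq_bigr => z _ /=; ring.
Qed.
End ZonalKernels.

(** * Ten-point codes are tight frames with two inner products *)

Section TenPointCode.
Variables (R : realType) (T : finType) (c : T -> 'rV[R]_4).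
Hypothesis cardT : #|T| = 10%N.
Hypothesis unit_c : forall t, dot (c t) (c t) = 1.
Hypothesis dot_le : forall x y, x != y -> dot (c x) (c y) <= 1 / 6.

Definition gap x y : R := (1 - 6 * dot (c x) (c y)) / 5.

Lemma gapC x y : gap x y = gap y x.
Proof. by rewrite /gap dotC. Qed.

Lemma gapxx x : gap x x = - 1.
Proof. by rewrite /gap unit_c; lra. Qed.

Lemma gap_ge0 x y : x != y -> 0 <= gap x y.
Proof. by move/dot_le; rewrite /gap; lra. Qed.

Lemma transverse_sum_ge0 x (f : T -> R) :
  0 <= \sum_y \sum_z f y * f z * transverse (gap x y) (gap x z) (gap y z).
Proof.
have := projected_gram_ge0 unit_c x f.
move=> /(dsumZ_ge0 (ler0n R 36)) /(dsumZ_ge0 (_ : 0 <= 1 / 5)) => h.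
have {h} := h ltac:(lra); congr (_ <= _).
by do 2!apply: eq_bigr => ? _; rewrite /transverse /gap; field.
Qed.

Lemma base_kernel_sum_ge0 x :
  0 <= \sum_y \sum_z base_kernel (gap x y) (gap x z) (gap y z).
Proof.
rewrite /base_kernel; do !apply: dsumD_ge0;
  apply: dsumZ_ge0; rewrite ?ler0n //;
  by [apply: dsum_square_ge0 | apply: transverse_sum_ge0].
Qed.

Lemma frame_kernel_sum :
  \sum_x \sum_y frame_kernel (gap x y) =
  36 * \sum_a \sum_b (frame_mx c - (5 / 2)%:M) a b ^+ 2.
Proof.
have trace : \sum_t dot (c t) (c t) = 10.
  by rewrite (eq_bigr (fun=> 1)) ?sumr_const ?cardT // => x _; apply: unit_c.
rewrite frame_deviation trace.
transitivity (\sum_x \sum_y (36 * dot (c x) (c y) ^+ 2 - 9)).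
  by do 2!apply: eq_bigr => ? _; rewrite /frame_kernel /gap; field.
under eq_bigr do rewrite big_split sumr_const cardT -mulr_sumr.
by rewrite big_split sumr_const cardT -mulr_sumr /=; lra.
Qed.

(** The three base kernels differ by the choice of the base point in the triple,
    hence have equal sums.  The factor 6480 is 216 * 3 * 10, as every pair lies
    in ten triples. *)
Lemma triple_kernel_sum :
  \sum_x \sum_y \sum_z triple_kernel (gap x y) (gap x z) (gap y z) =
  3 * (\sum_x \sum_y \sum_z base_kernel (gap x y) (gap x z) (gap y z))
  + 6480 * \sum_x \sum_y frame_kernel (gap x y).
Proof.
pose S (F : T -> T -> T -> R) := \sum_x \sum_y \sum_z F x y z.
have SD F G : S (fun x y z => F x y z + G x y z) = S F + S G.
  rewrite /S -big_split; apply: eq_bigr => x _; rewrite -big_split.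
  by apply: eq_bigr => y _; rewrite -big_split.
have SZ a F : S (fun x y z => a * F x y z) = a * S F.
  rewrite /S mulr_sumr; apply: eq_bigr => x _; rewrite mulr_sumr.
  by apply: eq_bigr => y _; rewrite mulr_sumr.
have S12 F : S F = S (fun x y z => F y x z) by rewrite /S exchange_big.
have S23 F : S F = S (fun x y z => F x z y).
  by apply: eq_bigr => x _; rewrite exchange_big.
have Sb2 : S (fun x y z => base_kernel (gap x y) (gap y z) (gap x z)) =
    S (fun x y z => base_kernel (gap x y) (gap x z) (gap y z)).
  rewrite S12; apply: eq_bigr => x _; apply: eq_bigr => y _.
  by apply: eq_bigr => z _; rewrite (gapC y x).
have Sb3 : S (fun x y z => base_kernel (gap x z) (gap y z) (gap x y)) =
    S (fun x y z => base_kernel (gap x y) (gap x z) (gap y z)).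
  rewrite S23 -Sb2; apply: eq_bigr => x _; apply: eq_bigr => y _.
  by apply: eq_bigr => z _; rewrite (gapC z y).
have Sf1 : S (fun x y _ => frame_kernel (gap x y)) =
    10 * \sum_x \sum_y frame_kernel (gap x y).
  rewrite mulr_sumr; apply: eq_bigr => x _; rewrite mulr_sumr.
  by apply: eq_bigr => y _; rewrite sumr_const cardT mulr_natl.
have Sf2 : S (fun x _ z => frame_kernel (gap x z)) =
    10 * \sum_x \sum_y frame_kernel (gap x y) by rewrite S23.
have Sf3 : S (fun _ y z => frame_kernel (gap y z)) =
    10 * \sum_x \sum_y frame_kernel (gap x y) by rewrite S12.
rewrite -[LHS]/(S _) /triple_kernel 3!SD (SZ 216) 2!SD Sb2 Sb3 Sf1 Sf2 Sf3 /S.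
lra.
Qed.

(** A sum of nonnegative terms, computed in a second way, is nonpositive: the
    case of equality of the three-point bound. *)
Lemma ten_point_rigidity :
  frame_mx c = (5 / 2)%:M /\
  forall x y z, distinct3 x y z -> slack (gap x y) (gap x z) (gap y z) = 0.
Proof.
have total := sum_triples cardT
  (fun x y z => triple_kernel (gap x y) (gap x z) (gap y z)).
move: total; rewrite triple_kernel_sum frame_kernel_sum.
have -> : sum3 (fun x y z => triple_kernel (gap x y) (gap x z) (gap y z)
    + (triple_kernel (gap x x) (gap x y) (gap x y)
       + triple_kernel (gap x z) (gap x x) (gap z x)
       + triple_kernel (gap y z) (gap y z) (gap z z)) / 8
    + triple_kernel (gap x x) (gap x x) (gap x x) / 72) =
    - sum3 (fun x y z => slack (gap x y) (gap x z) (gap y z)).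
  rewrite -mulrN1 -sum3M; apply: eq_sum3 => x y z _.
  by rewrite !gapxx (gapC z x) triple_kernel_certificate mulrN1.
set D := \sum_a \sum_b (_ ^+ 2); set S := sum3 _; set B := \sum_x _ => total.
have pos x y z : distinct3 x y z -> 0 <= slack (gap x y) (gap x z) (gap y z).
  by case/and3P => *; apply: slack_ge0; apply: gap_ge0.
have D0 : 0 <= D by do 2!apply: sumr_ge0 => ? _; apply: sqr_ge0.
have B0 : 0 <= B by apply: sumr_ge0 => x _; apply: base_kernel_sum_ge0.
have S0 : 0 <= S by do 3!apply: sumr_ge0 => ? ?; apply: pos.
split.
  (* total reads 3 B + 6480 * 36 D = - S, where B, D, S >= 0 *)
  have Dz : D = 0 by lra.
  apply/matrixP => a b; apply/eqP; rewrite -subr_eq0 -sqrf_eq0.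
  have row_ge0 a' : 0 <= \sum_b (frame_mx c - (5 / 2)%:M) a' b ^+ 2.
    by apply: sumr_ge0 => ? _; apply: sqr_ge0.
  have := psumr_eq0P (fun a' _ => row_ge0 a') Dz => /(_ a isT).
  move=> /(psumr_eq0P (fun b' _ => sqr_ge0 _)) => /(_ b isT).
  by rewrite !mxE => ->.
have Sz : S = 0 by lra.
move=> x y z xyz.
have pos2 x' y' : 0 <= \sum_(z' | distinct3 x' y' z')
    slack (gap x' y') (gap x' z') (gap y' z').
  by apply: sumr_ge0 => z'; apply: pos.
have pos1 x' : 0 <= \sum_y' \sum_(z' | distinct3 x' y' z')
    slack (gap x' y') (gap x' z') (gap y' z').
  by apply: sumr_ge0 => y' _; apply: pos2.
have := psumr_eq0P (fun x' _ => pos1 x') Sz => /(_ x isT).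
move=> /(psumr_eq0P (fun y' _ => pos2 x y')) => /(_ y isT).
by move=> /(psumr_eq0P (pos x y)); apply.
Qed.

Lemma dot_values x y : x != y ->
  dot (c x) (c y) = 1 / 6 \/ dot (c x) (c y) = - (2 / 3).
Proof.
move=> xy; have /card_gt0P[z] : (0 < #|[predC [set x; y]]|)%N.
  have := cardC [set x; y]; rewrite cards2 xy cardT => /= -[].
  by rewrite add0n => ->.
rewrite !inE negb_or !(eq_sym z) => /andP[xz yz].
have [_ slack0] := ten_point_rigidity.
have := slack1_le_slack (gap_ge0 xy) (gap_ge0 xz) (gap_ge0 yz).
rewrite slack0; last by apply/and3P.
move=> le0; have eq0 : slack1 (gap x y) = 0.
  by apply/eqP; rewrite eq_le le0 slack1_ge0 ?gap_ge0.
by have [] := slack1_eq0 eq0; rewrite /gap => ?; [left | right]; lra.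
Qed.

End TenPointCode.

(** * The graph of obtuse pairs *)

Section ObtuseGraph.
Variables (R : realType) (T : finType) (c : T -> 'rV[R]_4).
Hypothesis cardT : #|T| = 10%N.
Hypothesis unit_c : forall t, dot (c t) (c t) = 1.
Hypothesis dot_le : forall x y, x != y -> dot (c x) (c y) <= 1 / 6.

Definition obtuse x y := dot (c x) (c y) < 0.

Lemma obtuse_sym : symmetric obtuse.
Proof. by move=> x y; rewrite /obtuse dotC. Qed.

Lemma obtuse_irr : irreflexive obtuse.
Proof. by move=> x; rewrite /obtuse unit_c ltr10. Qed.

Lemma dot_obtuse x y :
  dot (c x) (c y) = 1 / 6 + 5 / 6 * (x == y)%:R - 5 / 6 * (obtuse x y)%:R.
Proof.
have [->|xy] := eqVneq x y; first by rewrite obtuse_irr unit_c /=; lra.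
have [e|e] := dot_values cardT unit_c dot_le xy; rewrite /obtuse e.
  by rewrite (_ : (1 / 6 < 0 :> R) = false) /=; [lra | apply/negP => ?; lra].
by rewrite (_ : (- (2 / 3) < 0 :> R) = true) /=; [lra | apply/idP; lra].
Qed.

Lemma sum_delta x (f : T -> R) : \sum_t (x == t)%:R * f t = f x.
Proof.
rewrite (bigD1 x) //= eqxx mul1r big1 ?addr0 // => t.
by rewrite eq_sym => /negPf->; rewrite mul0r.
Qed.

(** Entry (u, v) of the identity G^2 = (5/2) G, where G = (5/6) I + (1/6) J
    - (5/6) A for the adjacency matrix A and the all-ones matrix J.  The diagonal
    entries give the degrees, and then the others give A^2. *)
Lemma common_obtuse_sum x y :
  \sum_t (obtuse x t)%:R * (obtuse y t)%:R =
  (if x == y then 3 else 1 - (obtuse x y)%:R) :> R.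
Proof.
have tight u v :
    \sum_t dot (c u) (c t) * dot (c t) (c v) = 5 / 2 * dot (c u) (c v).
  have [fr _] := ten_point_rigidity cardT unit_c dot_le.
  by rewrite -frame_mxE fr mul_mx_scalar dotZl.
pose N u : R := \sum_t (obtuse u t)%:R.
pose M u v : R := \sum_t (obtuse u t)%:R * (obtuse v t)%:R.
have gram u v : 5 / 2 * dot (c u) (c v) =
    10 / 36 + 10 / 36 + 25 / 36 * (u == v)%:R - 5 / 36 * (N u + N v)
    - 50 / 36 * (obtuse u v)%:R + 25 / 36 * M u v.
  rewrite -tight.
  transitivity (\sum_t (1 / 36 + 5 / 36 * ((u == t)%:R * 1)
    + 5 / 36 * ((v == t)%:R * 1) + 25 / 36 * ((u == t)%:R * (v == t)%:R)
    - 5 / 36 * (obtuse u t)%:R - 5 / 36 * (obtuse v t)%:R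
    - 25 / 36 * ((u == t)%:R * (obtuse v t)%:R)
    - 25 / 36 * ((v == t)%:R * (obtuse u t)%:R)
    + 25 / 36 * ((obtuse u t)%:R * (obtuse v t)%:R) : R)).
    apply: eq_bigr => t _; rewrite !dot_obtuse (eq_sym t) (obtuse_sym t).
    by field.
  rewrite !big_split /= !sumrN -!mulr_sumr !sum_delta sumr_const cardT.
  by rewrite -/(N u) -/(N v) -/(M u v) (obtuse_sym v u) (eq_sym v); lra.
have deg u : N u = 3.
  have := gram u u; rewrite unit_c eqxx obtuse_irr.
  have -> : M u u = N u.
    by apply: eq_bigr => t _; rewrite -natrM mulnb andbb.
  by move=> /=; lra.
have := gram x y; rewrite !deg dot_obtuse -/(M x y).
have [->|xy] := eqVneq x y; last by move=> /=; lra.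
by rewrite obtuse_irr => /=; lra.
Qed.

Lemma card_common_obtuse x y :
  #|[set t | obtuse x t && obtuse y t]| =
  (if x == y then 3 else (~~ obtuse x y : nat))%N.
Proof.
apply/eqP; rewrite -(eqr_nat R).
have -> : #|[set t | obtuse x t && obtuse y t]|%:R =
    \sum_t (obtuse x t)%:R * (obtuse y t)%:R :> R.
  rewrite -sum1_card natr_sum big_mkcond; apply: eq_bigr => t _.
  by rewrite inE -natrM mulnb; case: (_ && _).
rewrite common_obtuse_sum; case: (x == y) => //.
by case: (obtuse x y); rewrite /= ?subrr ?subr0.
Qed.

End ObtuseGraph.

(** * Uniqueness of the Petersen graph *)

(** Vertex 0 is a root with neighbours 1, 2, 3; the pairs {4, 5}, {6, 7}, {8, 9}
    are the other neighbours of 1, 2, 3. *)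
Definition petersen_edges : seq (nat * nat) :=
  [:: (0, 1); (0, 2); (0, 3); (1, 4); (1, 5); (2, 6); (2, 7); (3, 8); (3, 9);
      (4, 6); (5, 7); (6, 8); (7, 9); (4, 9); (5, 8)]%N.

Definition petersen_adj (i j : 'I_10) : bool :=
  ((val i, val j) \in petersen_edges) || ((val j, val i) \in petersen_edges).

Lemma petersen_degree i : #|[set j | petersen_adj i j]| = 3%N.
Proof.
rewrite -sum1dep_card big_mkcond !big_ord_recl big_ord0 /=.
by case: i => [[|[|[|[|[|[|[|[|[|[|]]]]]]]]]] ?].
Qed.

Section PetersenGraph.
Variables (T : finType) (e : rel T).
Hypothesis cardT : #|T| = 10%N.
Hypothesis sym_e : symmetric e.
Hypothesis irr_e : irreflexive e.
Hypothesis card_common : forall x y,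
  #|[set t | e x t && e y t]| = (if x == y then 3 else (~~ e x y : nat))%N.

Lemma degree x : #|[set t | e x t]| = 3%N.
Proof.
have := card_common x x; rewrite eqxx => <-.
by apply: eq_card => t; rewrite !inE andbb.
Qed.

Lemma triangle_free u v w : e u v -> e u w -> e v w -> False.
Proof.
move=> uv uw vw; have := card_common u v; rewrite uv.
have [uv0|_] := eqVneq u v; first by rewrite uv0 irr_e in uv.
by move/eqP; rewrite cards_eq0 => /eqP/setP/(_ w); rewrite !inE uw vw.
Qed.

Lemma common_uniq u v w w' :
  u != v -> e u w -> e v w -> e u w' -> e v w' -> w = w'.
Proof.
move=> uv uw vw uw' vw'.
have : (#|[set t | e u t && e v t]| <= 1)%N.
  by rewrite card_common (negPf uv) leq_b1.
by move/card_le1_eqP; apply; rewrite inE ?uw ?vw ?uw' ?vw'.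
Qed.

Lemma common_exists u v : u != v -> ~~ e u v -> exists2 w, e u w & e v w.
Proof.
move=> uv nuv; have := card_common u v.
rewrite (negPf uv) nuv => /eqP/cards1P[w].
by move/setP/(_ w); rewrite !inE eqxx => /andP[]; exists w.
Qed.

Lemma neighbors u :
  exists x a b, uniq [:: x; a; b] /\ forall t, e u t = (t \in [:: x; a; b]).
Proof.
have := degree u; rewrite cardE; case E : (enum _) => [|x [|a [|b []]]] // _.
exists x, a, b; rewrite -E enum_uniq; split=> // t.
by rewrite mem_enum inE.
Qed.

Lemma neighbors1 u x : e u x ->
  exists a b, uniq [:: x; a; b] /\ forall t, e u t = (t \in [:: x; a; b]).
Proof.
have [y [a [b [uab Nu]]]] := neighbors u.
rewrite Nu => xs; have /rot_to[i s rs] := xs.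
have : size (rot i [:: y; a; b]) = 3%N by rewrite size_rot.
rewrite rs; case: s rs => [|a' [|b' []]] // rs _.
exists a', b'; rewrite -rs rot_uniq; split=> // t.
by rewrite mem_rot Nu.
Qed.

Lemma neighbors2 u x a : e u x -> e u a -> x != a ->
  exists b, uniq [:: x; a; b] /\ forall t, e u t = (t \in [:: x; a; b]).
Proof.
move=> ux; have [y [z [uyz Nu]]] := neighbors1 ux.
rewrite Nu !inE => /or3P[/eqP->|/eqP->|/eqP->]; rewrite ?eqxx // => _.
  by exists z.
exists y; split=> [|t]; last by rewrite Nu !inE [X in _ || X]orbC.
move: uyz; rewrite /= !inE !negb_or !andbT (eq_sym y z).
by move=> /andP[/andP[-> ->] ->].
Qed.

(** A point [u] at distance two from [x] behind [a] is neither equal nor adjacent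
    to another neighbour [b] of [x], since there are no triangles and no
    4-cycles.  So [u] and [b] have a common neighbour, which is not [x]. *)
Lemma bridge x a b u : e x a -> e x b -> a != b -> e a u -> u != x ->
  exists w, [/\ e u w, e b w & w != x].
Proof.
move=> xa xb ab au ux.
have ub : u != b.
  by apply: contraL au => /eqP->; apply/negP => /(triangle_free xa xb).
have nub : ~~ e u b.
  apply: contra ux => ub'; apply/eqP; apply: (common_uniq ab) => //.
  - by rewrite sym_e.
  - by rewrite sym_e.
  - by rewrite sym_e.
have [w uw bw] := common_exists ub nub; exists w; split=> //.
apply: contraTneq uw => ->; apply/negP => eux.
by apply: (triangle_free xa (_ : e x u) au); rewrite sym_e.
Qed.

(** Name a root, its three neighbours and one neighbour [a1] behind [a]; every
    later name is forced.  [b1] is the neighbour of [a1] behind [b], and [c1] the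
    neighbour of [b1] behind [c].  The remaining edges are obtained by [bridge],
    where one of the two candidates would close a triangle or a 4-cycle.  The ten
    named points exhaust the graph, hence are distinct, and an injective
    edge-preserving map between cubic graphs reflects edges. *)
Lemma petersen_labelling : exists f : 'I_10 -> T,
  injective f /\ forall i j, e (f i) (f j) = petersen_adj i j.
Proof.
have /card_gt0P[x _] : (0 < #|T|)%N by rewrite cardT.
have [a [b [c [Ux Nx]]]] := neighbors x.
have [xa xb xc] : [/\ e x a, e x b & e x c] by rewrite !Nx !inE !eqxx !orbT.
have [ab ac bc] : [/\ a != b, a != c & b != c].
  by move: Ux; rewrite /= !inE negb_or andbT => /andP[/andP[-> ->] ->].
have [ax bx cx] : [/\ e a x, e b x & e c x] by rewrite !(sym_e _ x).
have [a1 [a2 [Ua Na]]] := neighbors1 ax.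
have [a1x a2x a12] : [/\ a1 != x, a2 != x & a1 != a2].
  move: Ua; rewrite /= !inE negb_or andbT !(eq_sym x).
  by move=> /andP[/andP[-> ->] ->].
have [aa1 aa2] : e a a1 /\ e a a2 by rewrite !Na !inE !eqxx !orbT.
have [b1 [a1b1 bb1 b1x]] := bridge xa xb ab aa1 a1x.
have [b2 [Ub Nb]] : exists b2, uniq [:: x; b1; b2] /\
    forall t, e b t = (t \in [:: x; b1; b2]).
  by apply: neighbors2; rewrite // eq_sym.
have [bb2 b2x b12] : [/\ e b b2, b2 != x & b1 != b2].
  move: Ub; rewrite Nb /= !inE negb_or andbT !(eq_sym x) eqxx !orbT.
  by move=> /andP[/andP[_ ->] ->].
have [c1 [b1c1 cc1 c1x]] := bridge xb xc bc bb1 b1x.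
have [c2 [Uc Nc]] : exists c2, uniq [:: x; c1; c2] /\
    forall t, e c t = (t \in [:: x; c1; c2]).
  by apply: neighbors2; rewrite // eq_sym.
have [cc2 c2x c12] : [/\ e c c2, c2 != x & c1 != c2].
  move: Uc; rewrite Nc /= !inE negb_or andbT !(eq_sym x) eqxx !orbT.
  by move=> /andP[/andP[_ ->] ->].
have a2b2 : e a2 b2.
  have [w [a2w bw wx]] := bridge xa xb ab aa2 a2x.
  move: bw; rewrite Nb !inE (negPf wx) /= => /orP[]/eqP wE; last by rewrite -wE.
  have ab1 : a != b1.
    by apply: contraTneq bb1 => <-; apply/negP => /(triangle_free xb xa); apply.
  by case/eqP: a12; apply: (common_uniq ab1); rewrite // sym_e // -wE.
have b2c2 : e b2 c2.
  have [w [b2w cw wx]] := bridge xb xc bc bb2 b2x.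
  move: cw; rewrite Nc !inE (negPf wx) /= => /orP[]/eqP wE; last by rewrite -wE.
  have bc1 : b != c1.
    by apply: contraTneq cc1 => <-; apply/negP => /(triangle_free xc xb); apply.
  by case/eqP: b12; apply: (common_uniq bc1); rewrite // sym_e // -wE.
have a1c2 : e a1 c2.
  have [w [a1w cw wx]] := bridge xa xc ac aa1 a1x.
  move: cw; rewrite Nc !inE (negPf wx) /= => /orP[]/eqP wE; last by rewrite -wE.
  by case: (triangle_free a1b1 a1w); rewrite wE.
have a2c1 : e a2 c1.
  have [w [a2w cw wx]] := bridge xa xc ac aa2 a2x.
  move: cw; rewrite Nc !inE (negPf wx) /= => /orP[]/eqP wE; first by rewrite -wE.
  by case: (triangle_free a2b2 a2w); rewrite wE.
pose s := [:: x; a; b; c; a1; a2; b1; b2; c1; c2].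
have full t : t \in s.
  have [<-|xt] := eqVneq x t; first by rewrite inE eqxx.
  have [|nxt] := boolP (e x t).
    by rewrite Nx !inE => /or3P[]->; rewrite ?orbT.
  have [w] := common_exists xt nxt.
  rewrite Nx !inE sym_e => /or3P[]/eqP->; rewrite ?Na ?Nb ?Nc !inE;
    by move=> /or3P[]->; rewrite ?orbT.
have uniq_s : uniq s.
  apply/card_uniqP; rewrite (eq_card (B := T)) ?cardT //.
pose f (i : 'I_10) := nth x s i.
have inj_f : injective f.
  by move=> i j /eqP; rewrite nth_uniq // => /eqP/val_inj.
have edge (i j : 'I_10) : petersen_adj i j -> e (f i) (f j).
  have edges : all (fun ij => e (nth x s ij.1) (nth x s ij.2)) petersen_edges.
    rewrite /= xa xb xc aa1 aa2 bb1 bb2 cc1 cc2.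
    by rewrite a1b1 a2b2 b1c1 b2c2 a1c2 a2c1.
  by case/orP => /(allP edges) //=; rewrite sym_e.
exists f; split=> // i j; apply/idP/idP => [fij|/edge //].
have /eqP nbhd : f @: [set k | petersen_adj i k] == [set t | e (f i) t].
  rewrite eqEcard card_imset // petersen_degree degree andbT.
  by apply/subsetP => _ /imsetP[k ik ->]; move: ik; rewrite !inE; apply: edge.
have : f j \in [set t | e (f i) t] by rewrite inE.
by rewrite -nbhd => /imsetP[k]; rewrite inE => ik /inj_f->.
Qed.

End PetersenGraph.

(** * Congruence of codes *)

(** If X and Y are the matrices whose rows are the two codes, then
    X^T X = Y^T Y = (5/2) I and X X^T = Y Y^T, so that (2/5) X^T Y is orthogonal
    and maps X to Y. *)
Lemma congruent_families (R : realType) (T T' : finType)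
    (c : T -> 'rV[R]_4) (c' : T' -> 'rV[R]_4)
    (f : 'I_10 -> T) (f' : 'I_10 -> T') :
  bijective f -> bijective f' ->
  frame_mx c = (5 / 2)%:M -> frame_mx c' = (5 / 2)%:M ->
  (forall i j, dot (c (f i)) (c (f j)) = dot (c' (f' i)) (c' (f' j))) ->
  exists2 Q, orthogonal_mx Q & forall i, c (f i) *m Q = c' (f' i).
Proof.
move=> bij_f bij_f' frc frc' gram.
pose X := \matrix_i c (f i); pose Y := \matrix_i c' (f' i).
have XX : X^T *m X = (5 / 2)%:M.
  rewrite -frc; apply/matrixP => a b.
  rewrite !mxE [RHS](reindex f) /=; last exact: onW_bij.
  by apply: eq_bigr => i _; rewrite !mxE.
have YY : Y^T *m Y = (5 / 2)%:M.
  rewrite -frc'; apply/matrixP => a b.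
  rewrite !mxE [RHS](reindex f') /=; last exact: onW_bij.
  by apply: eq_bigr => i _; rewrite !mxE.
have XY : X *m X^T = Y *m Y^T.
  by apply/matrixP => i j; rewrite !dot_mulmx !rowK.
exists ((2 / 5) *: (X^T *m Y)) => [|i].
  rewrite /orthogonal_mx linearZ /= -scalemxAl -scalemxAr scalerA trmx_mul trmxK.
  rewrite !mulmxA -(mulmxA X^T) -XY mulmxA XX -mulmxA XX.
  rewrite -scalar_mxM scale_scalar_mx.
  by congr _%:M; field.
have -> : c (f i) = row i X by rewrite rowK.
rewrite -row_mul -scalemxAr mulmxA XY -mulmxA YY mul_mx_scalar scalerA.
by rewrite (_ : _ * _ = 1) ?scale1r ?rowK //; field.
Qed.

Section FsetCodes.
Variable R : realType.
Implicit Types C : {fset 'rV[R]_4}.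

Lemma code_family C : spherical_code 10 (1 / 6) C ->
  [/\ #|{: C}| = 10%N, forall t : C, dot (val t) (val t) = 1
    & forall x y : C, x != y -> dot (val x) (val y) <= 1 / 6].
Proof.
case=> cardC unitC sepC; split; first by rewrite -cardC cardfE.
- by move=> t; apply/enorm_eq1/unitC/valP.
- by move=> x y xy; apply: sepC; rewrite ?fsvalP // => /val_inj/eqP; apply/negP.
Qed.

Lemma code_labelling C : spherical_code 10 (1 / 6) C ->
  exists2 f : 'I_10 -> C, bijective f & forall i j,
    dot (val (f i)) (val (f j)) =
    1 / 6 + 5 / 6 * (i == j)%:R - 5 / 6 * (petersen_adj i j)%:R.
Proof.
move=> /code_family[cardT unit_c dot_le].
have [f [inj_f edge]] :=
  petersen_labelling cardT (obtuse_sym _) (obtuse_irr unit_c)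
    (card_common_obtuse cardT unit_c dot_le).
exists f => [|i j]; first by apply: inj_card_bij; rewrite // cardT card_ord.
by rewrite (dot_obtuse cardT unit_c dot_le) (inj_eq inj_f) edge.
Qed.

Lemma congruent_codes C C' :
  spherical_code 10 (1 / 6) C -> spherical_code 10 (1 / 6) C' ->
  exists Q : 'M[R]_4, orthogonal_mx Q /\ [fset x *m Q | x in C]%fset = C'.
Proof.
move=> hC hC'; have [f bij_f gram] := code_labelling hC.
have [f' bij_f' gram'] := code_labelling hC'.
have [cT uc lec] := code_family hC; have [cT' uc' lec'] := code_family hC'.
have [fr _] := ten_point_rigidity cT uc lec.
have [fr' _] := ten_point_rigidity cT' uc' lec'.
have [|Q orthoQ fQ] := congruent_families bij_f bij_f' fr fr'.
  by move=> i j; rewrite gram gram'.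
exists Q; split=> //; apply/fsetP => y; apply/imfsetP/idP => /= [[x xC ->]|yC'].
  have [g _ gK] := bij_f; have := fQ (g [` xC]%fset); rewrite gK /= => ->.
  exact: fsvalP.
have [g _ gK] := bij_f'; exists (val (f (g [` yC']%fset))); first exact: fsvalP.
by rewrite fQ gK.
Qed.

Lemma code_attains C t :
  spherical_code 10 (1 / 6) C -> spherical_code 10 t C -> 1 / 6 <= t.
Proof.
move=> hC [_ _ sepC]; have [f [g fK _] gram] := code_labelling hC.
(* two nonadjacent vertices of the Petersen graph *)
pose i : 'I_10 := Ordinal (isT : 0 < 10)%N.
pose j : 'I_10 := Ordinal (isT : 4 < 10)%N.
have ij : i != j by [].
have e : dot (val (f i)) (val (f j)) = 1 / 6.
  have nij : petersen_adj i j = false by [].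
  by rewrite gram nij (negPf ij) !mulr0 addr0 subr0.
rewrite -e; apply: sepC; rewrite ?fsvalP // => /val_inj/(can_inj fK)/eqP.
by rewrite (negPf ij).
Qed.

End FsetCodes.

(** * The Petersen code *)

(** Summing the squared edge lengths at one vertex, where the cross terms cancel
    because the centroid is 0, shows that all vertices have the same norm. *)
Lemma simplex_gram (R : realType) (n : nat) (v : 'I_n.+1 -> 'rV[R]_n) :
  centered_regular_simplex v ->
  exists2 s : R, 0 < s &
    forall i j, dot (v i) (v j) = (n.+1%:R * (i == j)%:R - 1) * s.
Proof.
case=> sum_v [d d_gt0 dist]; pose D := d ^+ 2.
have [N NE N_gt0] : exists2 N : R, n.+1%:R = N & 0 < N.
  by exists n.+1%:R; rewrite ?ltr0n.
rewrite NE.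
have sq i j : i != j ->
    dot (v i) (v i) + dot (v j) (v j) - 2 * dot (v i) (v j) = D.
  move=> /dist dij; rewrite /D -dij sqr_sqrtr ?dot_ge0 //.
  by rewrite dotBl !dotBr (dotC (v j) (v i)); ring.
pose S := \sum_i dot (v i) (v i).
have norms i : N * dot (v i) (v i) + S = D * (N - 1).
  transitivity
    (\sum_j (dot (v i) (v i) + dot (v j) (v j) - 2 * dot (v i) (v j))).
    rewrite !big_split /= sumr_const card_ord sumrN -mulr_sumr -dot_sumr sum_v.
    by rewrite dotC dot0l mulr0 subr0 -mulr_natl NE.
  rewrite (bigD1 i) //= (eq_bigr (fun=> D)); last first.
    by move=> j; rewrite eq_sym => /sq.
  by rewrite sumr_const cardC1 card_ord /= -mulr_natl -NE -(natr1 n); ring.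
have S_val : 2 * S = D * (N - 1).
  apply: (mulfI (lt0r_neq0 N_gt0)).
  have : \sum_(i < n.+1) (N * dot (v i) (v i) + S) = \sum_(i < n.+1) D * (N - 1).
    by apply: eq_bigr => i _; apply: norms.
  rewrite big_split /= !sumr_const card_ord -mulr_sumr -/S.
  rewrite -(mulr_natl S) -(mulr_natl (D * _)) NE.
  by move=> <-; ring.
have norm_val i : dot (v i) (v i) = (N - 1) * (D / (2 * N)).
  apply: (mulfI (lt0r_neq0 N_gt0)); have := norms i.
  move=> e; have -> : N * dot (v i) (v i) = D * (N - 1) - S by rewrite -e; ring.
  have -> : S = D * (N - 1) / 2 by rewrite -S_val; field.
  by field; rewrite lt0r_neq0.
exists (D / (2 * N)) => [|i j]; first by rewrite divr_gt0 ?exprn_gt0 ?mulr_gt0.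
have [->|ij] := eqVneq i j; first by rewrite mulr1 norm_val.
have := sq i j ij; rewrite !norm_val mulr0 => e.
set L := (N - 1) * _ in e.
have -> : dot (v i) (v j) = (L + L - D) / 2 by rewrite -[D]e; field.
by rewrite /L; field; rewrite lt0r_neq0.
Qed.

Section PetersenCode.
Variables (R : realType) (v : 'I_5 -> 'rV[R]_4).
Hypothesis simplex_v : centered_regular_simplex v.
Implicit Types e : {set 'I_5}.

(** With vertex Gram matrix (5 I - J) s, the midpoints of edges e and e' have
    inner product (5 k - 4) s / 4 for k common endpoints; k = 2 gives their
    squared norm 3 s / 2. *)
Lemma dot_edges e e' : #|e| = 2%N -> #|e'| = 2%N ->
  dot (normalize (edge_midpoint v e)) (normalize (edge_midpoint v e')) =
  (5 * #|e :&: e'|%:R - 4) / 6.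
Proof.
have [s s_gt0 gram] := simplex_gram simplex_v.
have mid e1 e2 : #|e1| = 2%N -> #|e2| = 2%N ->
    dot (edge_midpoint v e1) (edge_midpoint v e2) =
    (5 * #|e1 :&: e2|%:R - 4) / 6 * (3 * s / 2).
  move=> c1 c2; rewrite dotZl dotZr dot_suml.
  transitivity (2^-1 * (2^-1 * (5 * s * #|e1 :&: e2|%:R - 4 * s)));
    last by field.
  congr (_ * (_ * _)).
  transitivity (\sum_(i in e1) (5 * s * (i \in e2)%:R - 2 * s)).
    apply: eq_bigr => i _; rewrite dot_sumr.
    rewrite (eq_bigr (fun j => 5 * s * (i == j)%:R - s)); last first.
      by move=> j _; rewrite gram; ring.
    rewrite big_split /= sumr_const c2 -mulr_sumr.
    congr (_ * _ + _); last by rewrite -mulr_natl; ring.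
    case: (boolP (i \in e2)) => ie.
      rewrite (bigD1 i) //= eqxx big1 ?addr0 // => j /andP[_].
      by rewrite eq_sym => /negPf->.
    by rewrite big1 // => j je; case: eqP => // ij; rewrite ij je in ie.
  rewrite big_split /= sumr_const c1 -mulr_sumr.
  congr (_ * _ + _); last by rewrite -mulr_natl; ring.
  rewrite -sum1_card natr_sum [RHS]big_mkcond [LHS]big_mkcond.
  apply: eq_bigr => i _.
  by rewrite inE; case: (i \in e1); case: (i \in e2).
have sq_mid e1 : #|e1| = 2%N ->
    dot (edge_midpoint v e1) (edge_midpoint v e1) = 3 * s / 2.
  by move=> c1; rewrite mid // setIid c1; field.
move=> c c'; rewrite dotZl dotZr mid // /enorm !sq_mid // mulrA -expr2 exprVn.
rewrite sqr_sqrtr; last by lra.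
by field; rewrite gt_eqF.
Qed.

Lemma petersen_spherical : spherical_code 10 (1 / 6) (petersen_code v).
Proof.
have cap2 e e' : #|e| = 2%N -> #|e'| = 2%N -> e != e' -> (#|e :&: e'| <= 1)%N.
  move=> c c' ee'; rewrite -ltnS -[X in (_ < X)%N]c; apply: proper_card.
  rewrite properEneq subsetIl andbT; apply: contraNneq ee' => /setIidPl sub.
  by rewrite eqEcard sub c c'.
have inj e e' : #|e| = 2%N -> #|e'| = 2%N ->
    normalize (edge_midpoint v e) = normalize (edge_midpoint v e') -> e = e'.
  move=> c c' ee'; apply/eqP; apply: contraT => ne.
  have := dot_edges c c'; rewrite -ee' dot_edges // setIid c.
  by have := cap2 _ _ c c' ne; case: #|_| => [|[|]] // _; lra.
split.
- rewrite card_in_imfset /=; last by move=> e e' /eqP c /eqP c'; apply: inj.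
  have := card_draws 'I_5 2%N; rewrite card_ord cardE -[10%N]/'C(5, 2) => <-.
  by rewrite enumT /enum_mem; congr size; apply: eq_filter => e; rewrite !inE.
- move=> _ /imfsetP[e /= /eqP c ->]; rewrite /enorm dot_edges // setIid c.
  by rewrite (_ : _ / _ = 1) ?sqrtr1 //; field.
- move=> _ _ /imfsetP[e /= /eqP c ->] /imfsetP[e' /= /eqP c' ->] ne.
  have ee' : e != e' by apply/eqP => ee'; apply: ne; rewrite ee'.
  rewrite dot_edges //; have := cap2 _ _ c c' ee'.
  by case: #|_| => [|[|]] // _; lra.
Qed.
End PetersenCode.

(** * Optimality and uniqueness *)

Local Open Scope fset_scope.

Theorem theorem1p1 (R : realType) (v : 'I_5 -> 'rV[R]_4)
    (hv : centered_regular_simplex v) :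
  optimal_code 10 (1 / 6) (petersen_code v) /\
  (forall C : {fset 'rV[R]_4}, spherical_code 10 (1 / 6) C ->
     exists Q : 'M[R]_4,
       orthogonal_mx Q /\ [fset x *m Q | x in C] = petersen_code v).
Proof.
have petersen := petersen_spherical hv; split; last first.
  by move=> C hC; apply: congruent_codes.
split=> // -[t' [C [t'_lt hC]]].
have hC6 : spherical_code 10 (1 / 6) C.
  case: hC => cardC unitC sepC; split=> // c c' cC c'C cc'.
  exact: le_trans (sepC _ _ cC c'C cc') (ltW t'_lt).
by have := code_attains hC6 hC; rewrite leNgt t'_lt.
Qed.
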